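(* Let $\gamma_1,\gamma_2\in\mathbb{R}\setminus\{0\}$, let $\{1,e_1,e_2,e_3\}$ be the canonical basis of $\mathbb{H}(\gamma_1,\gamma_2)$, $\{1,i,j,k\}$ the canonical basis of $\mathbb{H}(1,1)$ and $\{1,i_1,i_2,i_3\}$ the canonical basis of $\mathbb{H}(1,-1)$. (A) If $\gamma_1,\gamma_2>0$, the $\mathbb{R}$-linear map $A:\mathbb{H}(\gamma_1,\gamma_2)\to\mathbb{H}(1,1)$ with $A(1)=1$, $A(e_1)=\sqrt{\gamma_1}\,i$, $A(e_2)=\sqrt{\gamma_2}\,j$, $A(e_3)=\sqrt{\gamma_1\gamma_2}\,k$ is an isomorphism of algebras. (B) If $\gamma_1,\gamma_2<0$, the $\mathbb{R}$-linear map $B:\mathbb{H}(\gamma_1,\gamma_2)\to\mathbb{H}(1,-1)$ with $B(1)=1$, $B(e_1)=\sqrt{-\gamma_1}\,i_3$, $B(e_2)=\sqrt{-\gamma_2}\,i_2$, $B(e_3)=\sqrt{\gamma_1\gamma_2}\,i_1$ is an isomorphism of algebras. (C) If $\gamma_1>0$, $\gamma_2<0$, the $\mathbb{R}$-linear map $C:\mathbb{H}(\gamma_1,\gamma_2)\to\mathbb{H}(1,-1)$ with $C(1)=1$, $C(e_1)=\sqrt{\gamma_1}\,i_1$, $C(e_2)=\sqrt{-\gamma_2}\,i_2$, $C(e_3)=\sqrt{-\gamma_1\gamma_2}\,i_3$ is an isomorphism of algebras. (D) If $\gamma_1<0$, $\gamma_2>0$, the $\mathbb{R}$-linear map $D:\mathbb{H}(\gamma_1,\gamma_2)\to\mathbb{H}(1,-1)$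 with $D(1)=1$, $D(e_1)=\sqrt{-\gamma_1}\,i_3$, $D(e_2)=\sqrt{\gamma_2}\,i_1$, $D(e_3)=\sqrt{-\gamma_1\gamma_2}\,i_2$ is an isomorphism of algebras.
   Context: For $\gamma_1,\gamma_2\in\mathbb{R}\setminus\{0\}$, the generalized quaternion algebra $\mathbb{H}(\gamma_1,\gamma_2)$ is the associative unital real algebra with basis $\{1,e_1,e_2,e_3\}$ and multiplication $e_1^2=-\gamma_1$, $e_2^2=-\gamma_2$, $e_3^2=-\gamma_1\gamma_2$, $e_1e_2=-e_2e_1=e_3$, $e_2e_3=-e_3e_2=\gamma_2e_1$, $e_3e_1=-e_1e_3=\gamma_1e_2$. $\mathbb{H}(1,1)$ is the division quaternion algebra (its canonical basis is written $1,i,j,k$ instead of $1,e_1,e_2,e_3$) and $\mathbb{H}(1,-1)$ is the algebra of coquaternions (its canonical basis is written $1,i_1,i_2,i_3$ instead of $1,e_1,e_2,e_3$). *)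

(* Defs.v *)
From HB Require Import structures.
From mathcomp Require Import all_boot all_order all_algebra ring.
From mathcomp Require Export reals.

Set Implicit Arguments.
Unset Strict Implicit.
Unset Printing Implicit Defensive.

Import Order.TTheory GRing.Theory Num.Theory.
Local Open Scope ring_scope.

(* Quat a0 a1 a2 a3 stands for a0 + a1 e_1 + a2 e_2 + a3 e_3.  The parameters
   g1 and g2 do not occur in the fields: they only select the product. *)
Record genquat (R : realType) (g1 g2 : R) : Type := Quat {
  qc0 : R;
  qc1 : R;
  qc2 : R;
  qc3 : R
}.

Arguments Quat {R g1 g2} _ _ _ _.

Section GenQuat.
Variables (R : realType) (g1 g2 : R).
Local Notation H := (genquat g1 g2).
Implicit Types (a b : R) (x y z : H).

Definition quat_to_tuple x := (qc0 x, qc1 x, qc2 x, qc3 x).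
Definition tuple_to_quat (t : R * R * R * R) : H :=
  let: (a0, a1, a2, a3) := t in Quat a0 a1 a2 a3.

Lemma quat_to_tupleK : cancel quat_to_tuple tuple_to_quat.
Proof. by case. Qed.

HB.instance Definition _ := Choice.copy H (can_type quat_to_tupleK).

Definition quat_add x y : H :=
  Quat (qc0 x + qc0 y) (qc1 x + qc1 y) (qc2 x + qc2 y) (qc3 x + qc3 y).
Definition quat_opp x : H := Quat (- qc0 x) (- qc1 x) (- qc2 x) (- qc3 x).
Definition quat_scale a x : H :=
  Quat (a * qc0 x) (a * qc1 x) (a * qc2 x) (a * qc3 x).

(* The bilinear extension of the multiplication table; the table itself is
   recovered in genquat_mul_table below. *)
Definition quat_mul x y : H :=
  let: Quat a0 a1 a2 a3 := x in
  let: Quat b0 b1 b2 b3 := y in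
  Quat (a0 * b0 - g1 * (a1 * b1) - g2 * (a2 * b2) - g1 * g2 * (a3 * b3))
       (a0 * b1 + a1 * b0 + g2 * (a2 * b3 - a3 * b2))
       (a0 * b2 + a2 * b0 + g1 * (a3 * b1 - a1 * b3))
       (a0 * b3 + a3 * b0 + (a1 * b2 - a2 * b1)).

Local Ltac quat_ring :=
  rewrite /quat_add /quat_opp /quat_scale /quat_mul /=; congr Quat; ring.

Fact quat_addA : associative quat_add.
Proof. by move=> [????] [????] [????]; quat_ring. Qed.
Fact quat_addC : commutative quat_add.
Proof. by move=> [????] [????]; quat_ring. Qed.
Fact quat_add0 : left_id (Quat 0 0 0 0) quat_add.
Proof. by move=> [????]; quat_ring. Qed.
Fact quat_addN : left_inverse (Quat 0 0 0 0) quat_opp quat_add.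
Proof. by move=> [????]; quat_ring. Qed.

HB.instance Definition _ :=
  GRing.isZmodule.Build H quat_addA quat_addC quat_add0 quat_addN.

Fact quat_mulA : associative quat_mul.
Proof. by move=> [????] [????] [????]; quat_ring. Qed.
Fact quat_mul1l : left_id (Quat 1 0 0 0) quat_mul.
Proof. by move=> [????]; quat_ring. Qed.
Fact quat_mul1r : right_id (Quat 1 0 0 0) quat_mul.
Proof. by move=> [????]; quat_ring. Qed.
Fact quat_mulDl : left_distributive quat_mul +%R.
Proof. by move=> [????] [????] [????]; rewrite /+%R /=; quat_ring. Qed.
Fact quat_mulDr : right_distributive quat_mul +%R.
Proof. by move=> [????] [????] [????]; rewrite /+%R /=; quat_ring. Qed.
Fact quat_1_neq0 : Quat 1 0 0 0 != 0 :> H.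
Proof. by apply/eqP => -[] /eqP; rewrite oner_eq0. Qed.

HB.instance Definition _ := GRing.Zmodule_isNzRing.Build H
  quat_mulA quat_mul1l quat_mul1r quat_mulDl quat_mulDr quat_1_neq0.

Fact quat_scaleA a b x : quat_scale a (quat_scale b x) = quat_scale (a * b) x.
Proof. by quat_ring. Qed.
Fact quat_scale1 : left_id 1 quat_scale.
Proof. by move=> [????]; quat_ring. Qed.
Fact quat_scaleDr : right_distributive quat_scale +%R.
Proof. by move=> a [????] [????]; rewrite /+%R /=; quat_ring. Qed.
Fact quat_scaleDl x : {morph quat_scale^~ x : a b / a + b}.
Proof. by move=> a b; rewrite [RHS]/+%R /=; quat_ring. Qed.

HB.instance Definition _ := GRing.Zmodule_isLmodule.Build R H
  quat_scaleA quat_scale1 quat_scaleDr quat_scaleDl.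

Fact quat_scaleAl a x y : a *: (x * y) = (a *: x) * y.
Proof.
by case: x y => [????] [????]; rewrite /*:%R /*%R /=; quat_ring.
Qed.

HB.instance Definition _ := GRing.Lmodule_isLalgebra.Build R H quat_scaleAl.

Fact quat_scaleAr a x y : a *: (x * y) = x * (a *: y).
Proof.
by case: x y => [????] [????]; rewrite /*:%R /*%R /=; quat_ring.
Qed.

HB.instance Definition _ := GRing.Lalgebra_isAlgebra.Build R H quat_scaleAr.

Definition qe1 : H := Quat 0 1 0 0.
Definition qe2 : H := Quat 0 0 1 0.
Definition qe3 : H := Quat 0 0 0 1.

Lemma quat_addE x y : x + y = quat_add x y. Proof. by []. Qed.
Lemma quat_oppE x : - x = quat_opp x. Proof. by []. Qed.
Lemma quat_oneE : 1 = Quat 1 0 0 0 :> H. Proof. by []. Qed.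
Lemma quat_mulE x y : x * y = quat_mul x y. Proof. by []. Qed.
Lemma quat_scaleE a x : a *: x = quat_scale a x. Proof. by []. Qed.

(* 1, e_1, e_2, e_3 is a basis: since Quat is a constructor, this gives both
   spanning and linear independence. *)
Lemma genquat_basisE a0 a1 a2 a3 :
  a0 *: 1 + a1 *: qe1 + a2 *: qe2 + a3 *: qe3 = Quat a0 a1 a2 a3 :> H.
Proof.
by rewrite !quat_addE !quat_scaleE quat_oneE; quat_ring.
Qed.

Lemma genquat_mul_table :
  [/\ qe1 * qe1 = (- g1) *: 1, qe2 * qe2 = (- g2) *: 1
    & qe3 * qe3 = (- (g1 * g2)) *: 1] /\
  [/\ qe1 * qe2 = qe3 /\ qe2 * qe1 = - qe3,
      qe2 * qe3 = g2 *: qe1 /\ qe3 * qe2 = - (g2 *: qe1)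
    & qe3 * qe1 = g1 *: qe2 /\ qe1 * qe3 = - (g1 *: qe2)].
Proof.
by split; split; try split;
  rewrite ?quat_oppE ?quat_scaleE ?quat_oneE ?quat_mulE; quat_ring.
Qed.

End GenQuat.

Definition algebra_isomorphism (R : realType) (U V : algType R) (f : U -> V)
    : Prop :=
  [/\ linear f, GRing.monoid_morphism f & bijective f].

(* Main.v *)
Require Import Defs.
From HB Require Import structures.
From mathcomp Require Import all_boot all_order all_algebra ring.
From mathcomp Require Import reals.

Import Order.TTheory GRing.Theory Num.Theory.
Local Open Scope ring_scope.

(** The algebra H(g1, g2) is presented by e_1^2 = - g1, e_2^2 = - g2 and
    e_2 e_1 = - e_1 e_2, so a linear map that sends 1 to 1 and e_3 to the
    product of the images of e_1 and e_2 is multiplicative as soon as those two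
    images satisfy the three relations (lemma [genquat_monoid_morphism]).

    Each of the four maps sends e_1 and e_2 to multiples s b1 and t b2 of two
    anticommuting basis units of the target, and e_3 to s t (b1 b2).  The
    relations then reduce to s^2 b1^2 = - g1 and t^2 b2^2 = - g2, and the signs
    of g1 and g2 dictate which units, of square 1 or - 1, can serve as b1 and
    b2.  The map is bijective because it rescales coordinates by the nonzero
    factors 1, s, t, s t before sending a basis to a basis (lemma
    [scaled_units_isomorphism]).  The four cases differ only in the choice of
    b1 and b2 among the units of H(1, 1) or H(1, -1). *)

Section LinearMaps.
Variables (R : realType) (g1 g2 : R).
Local Notation H := (genquat g1 g2).

Definition quat_lin (V : algType R) (u1 u2 u3 : V) (x : H) : V :=
  qc0 x *: 1 + qc1 x *: u1 + qc2 x *: u2 + qc3 x *: u3.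

Fact quat_lin_is_linear (V : algType R) (u1 u2 u3 : V) :
  linear (quat_lin V u1 u2 u3).
Proof.
move=> a [x0 x1 x2 x3] [y0 y1 y2 y3]; rewrite /quat_lin /= !scalerDr !scalerA.
rewrite !scalerDl [RHS]addrACA; congr (_ + _).
by rewrite [RHS]addrACA; congr (_ + _); rewrite [RHS]addrACA.
Qed.

HB.instance Definition _ (V : algType R) (u1 u2 u3 : V) :=
  GRing.isLinear.Build R H V *:%R (quat_lin V u1 u2 u3)
    (quat_lin_is_linear V u1 u2 u3).

Lemma quat_lin_basis (V : algType R) (u1 u2 u3 : V) :
  [/\ quat_lin V u1 u2 u3 1 = 1, quat_lin V u1 u2 u3 (qe1 g1 g2) = u1,
      quat_lin V u1 u2 u3 (qe2 g1 g2) = u2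
    & quat_lin V u1 u2 u3 (qe3 g1 g2) = u3].
Proof.
by split; rewrite /quat_lin /= ?quat_oneE /= !scale0r !scale1r ?add0r ?addr0.
Qed.

Lemma linear_quatE (V : algType R) (f : {linear H -> V}) (x : H) :
  f 1 = 1 ->
  f x = quat_lin V (f (qe1 g1 g2)) (f (qe2 g1 g2)) (f (qe3 g1 g2)) x.
Proof.
by case: x => x0 x1 x2 x3 f1; rewrite -[in LHS]genquat_basisE !linearD !linearZ /= f1.
Qed.

(** The rest of the multiplication table follows from these relations by
    associativity, for instance e_2 e_3 = - e_2 e_2 e_1 = g2 e_1. *)
Lemma genquat_monoid_morphism (V : algType R) (f : {linear H -> V}) :
  f 1 = 1 ->
  f (qe1 g1 g2) * f (qe1 g1 g2) = (- g1) *: 1 ->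
  f (qe2 g1 g2) * f (qe2 g1 g2) = (- g2) *: 1 ->
  f (qe1 g1 g2) * f (qe2 g1 g2) = f (qe3 g1 g2) ->
  f (qe2 g1 g2) * f (qe1 g1 g2) = - f (qe3 g1 g2) ->
  GRing.monoid_morphism f.
Proof.
move=> f1 f11 f22 f12 f21; split=> // x y.
rewrite (linear_quatE V f (x * y)) // (linear_quatE V f x) //.
rewrite (linear_quatE V f y) //.
move: f11 f22 f12 f21; move: (f (qe1 _ _)) (f (qe2 _ _)) (f (qe3 _ _)).
move=> u1 u2 u3 u11 u22 u12 u21.
have u13 : u1 * u3 = (- g1) *: u2 by rewrite -u12 mulrA u11 -scalerAl mul1r.
have u32 : u3 * u2 = (- g2) *: u1 by rewrite -u12 -mulrA u22 -scalerAr mulr1.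
have u23 : u2 * u3 = g2 *: u1.
  by rewrite -[u3]opprK -u21 mulrN mulrA u22 -scalerAl mul1r scaleNr opprK.
have u31 : u3 * u1 = g1 *: u2.
  by rewrite -[u3]opprK -u21 mulNr -mulrA u11 -scalerAr mulr1 scaleNr opprK.
have u33 : u3 * u3 = (- (g1 * g2)) *: 1.
  by rewrite -{1}u12 -mulrA u23 -scalerAr u11 scalerA mulrN mulrC.
case: x y => [x0 x1 x2 x3] [y0 y1 y2 y3]; rewrite /quat_lin /=.
rewrite !mulrDl !mulrDr -!scalerAl -!scalerAr !mul1r !mulr1 !scalerA.
rewrite u11 u22 u33 u12 u21 u13 u31 u23 u32 -!scaleN1r !scalerA.
(* Both sides are now sums of multiples of 1, u1, u2, u3.  These may be linearly
   dependent in V, so the sums are pulled back along quat_lin, where comparing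
   coordinates is legitimate. *)
have e0 c : c *: 1 = quat_lin V u1 u2 u3 (Quat c 0 0 0).
  by rewrite /quat_lin /= !scale0r !addr0.
have e1 c : c *: u1 = quat_lin V u1 u2 u3 (Quat 0 c 0 0).
  by rewrite /quat_lin /= !scale0r add0r !addr0.
have e2 c : c *: u2 = quat_lin V u1 u2 u3 (Quat 0 0 c 0).
  by rewrite /quat_lin /= !scale0r !add0r !addr0.
have e3 c : c *: u3 = quat_lin V u1 u2 u3 (Quat 0 0 0 c).
  by rewrite /quat_lin /= !scale0r !add0r.
rewrite !(e0, e1, e2, e3) -!linearD /=; congr quat_lin.
by rewrite !quat_addE /quat_add /=; congr Quat; ring.
Qed.

(** The map f is the rescaling of coordinates by 1, s, t, s t followed by
    [quat_lin V b1 b2 b3].  The rescaling is invertible because s and t are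
    nonzero, which s^2 c1 = - g1 and t^2 c2 = - g2 force. *)
Lemma scaled_units_isomorphism (V : algType R) (b1 b2 b3 : V) (c1 c2 s t r : R) :
  g1 != 0 -> g2 != 0 ->
  bijective (quat_lin V b1 b2 b3) ->
  b1 * b1 = c1 *: 1 -> b2 * b2 = c2 *: 1 ->
  b1 * b2 = b3 -> b2 * b1 = - b3 ->
  s ^+ 2 * c1 = - g1 -> t ^+ 2 * c2 = - g2 -> r = s * t ->
  let spec (f : {linear H -> V}) :=
    [/\ f 1 = 1, f (qe1 g1 g2) = s *: b1, f (qe2 g1 g2) = t *: b2
      & f (qe3 g1 g2) = r *: b3] in
  (exists f, spec f) /\ (forall f, spec f -> algebra_isomorphism f).
Proof.
move=> g1n0 g2n0 bij_b b11 b22 b12 b21 sc tc -> spec; split.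
  by exists (quat_lin V (s *: b1) (t *: b2) ((s * t) *: b3));
    exact: quat_lin_basis.
move=> f [f1 fe1 fe2 fe3].
have sn0 : s != 0.
  by apply: contra_neq g1n0 => s0; rewrite -[g1]opprK -sc s0 expr0n mul0r oppr0.
have tn0 : t != 0.
  by apply: contra_neq g2n0 => t0; rewrite -[g2]opprK -tc t0 expr0n mul0r oppr0.
split; first exact: linearP.
  apply: genquat_monoid_morphism; rewrite ?fe1 ?fe2 ?fe3 //
    -scalerAl -scalerAr scalerA.
  - by rewrite b11 scalerA -expr2 sc.
  - by rewrite b22 scalerA -expr2 tc.
  - by rewrite b12.
  - by rewrite b21 scalerN mulrC.
pose scale (a b : R) (x : H) : H :=
  Quat (qc0 x) (a * qc1 x) (b * qc2 x) (a * b * qc3 x).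
have fE : quat_lin V b1 b2 b3 \o scale s t =1 f.
  move=> x; rewrite (linear_quatE V f x f1) fe1 fe2 fe3 /quat_lin /= !scalerA.
  by congr (_ + _ *: _ + _ *: _ + _ *: _); ring.
apply: eq_bij fE; apply: bij_comp => //.
exists (scale s^-1 t^-1) => -[x0 x1 x2 x3]; rewrite /scale /=;
  by congr Quat; field; rewrite ?sn0 ?tn0.
Qed.

End LinearMaps.

Local Ltac quat_coords :=
  move=> [? ? ? ?];
  rewrite /quat_lin !quat_addE !quat_scaleE quat_oneE /quat_add /quat_scale /=;
  congr Quat; ring.

Theorem mainTheorem1 (R : realType) (g1 g2 : R)
    (g1_neq0 : g1 != 0) (g2_neq0 : g2 != 0) :
  [/\ (let specA (A : {linear genquat g1 g2 -> genquat (1 : R) 1}) :=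
         [/\ A 1 = 1,
             A (qe1 g1 g2) = Num.sqrt g1 *: qe1 1 1,
             A (qe2 g1 g2) = Num.sqrt g2 *: qe2 1 1
           & A (qe3 g1 g2) = Num.sqrt (g1 * g2) *: qe3 1 1] in
       0 < g1 -> 0 < g2 ->
       (exists A, specA A) /\ (forall A, specA A -> algebra_isomorphism A)),
      (let specB (B : {linear genquat g1 g2 -> genquat (1 : R) (- 1)}) :=
         [/\ B 1 = 1,
             B (qe1 g1 g2) = Num.sqrt (- g1) *: qe3 1 (- 1),
             B (qe2 g1 g2) = Num.sqrt (- g2) *: qe2 1 (- 1)
           & B (qe3 g1 g2) = Num.sqrt (g1 * g2) *: qe1 1 (- 1)] in
       g1 < 0 -> g2 < 0 ->
       (exists B, specB B) /\ (forall B, specB B -> algebra_isomorphism B)),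
      (let specC (C : {linear genquat g1 g2 -> genquat (1 : R) (- 1)}) :=
         [/\ C 1 = 1,
             C (qe1 g1 g2) = Num.sqrt g1 *: qe1 1 (- 1),
             C (qe2 g1 g2) = Num.sqrt (- g2) *: qe2 1 (- 1)
           & C (qe3 g1 g2) = Num.sqrt (- (g1 * g2)) *: qe3 1 (- 1)] in
       0 < g1 -> g2 < 0 ->
       (exists C, specC C) /\ (forall C, specC C -> algebra_isomorphism C))
    & (let specD (D : {linear genquat g1 g2 -> genquat (1 : R) (- 1)}) :=
         [/\ D 1 = 1,
             D (qe1 g1 g2) = Num.sqrt (- g1) *: qe3 1 (- 1),
             D (qe2 g1 g2) = Num.sqrt g2 *: qe1 1 (- 1)
           & D (qe3 g1 g2) = Num.sqrt (- (g1 * g2)) *: qe2 1 (- 1)] in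
       g1 < 0 -> 0 < g2 ->
       (exists D, specD D) /\ (forall D, specD D -> algebra_isomorphism D))].
Proof.
have [[i1i1 i2i2 i3i3] [[i1i2 i2i1] [i2i3 i3i2] [i3i1 i1i3]]] :=
  genquat_mul_table (1 : R) (- 1).
split=> specX hg1 hg2.
- have [[ii jj _] [[ij ji] _ _]] := genquat_mul_table (1 : R) 1.
  apply: (scaled_units_isomorphism R g1 g2 _
      (qe1 1 1) (qe2 1 1) (qe3 1 1) (- 1) (- 1)) => //.
  + exists (fun y => Quat (qc0 y) (qc1 y) (qc2 y) (qc3 y)); quat_coords.
  + by rewrite sqr_sqrtr ?ltW // mulrN1.
  + by rewrite sqr_sqrtr ?ltW // mulrN1.
  + by rewrite sqrtrM // ltW.
- have [pos1 pos2] : 0 < - g1 /\ 0 < - g2 by rewrite !oppr_gt0.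
  apply: (scaled_units_isomorphism R g1 g2 _
      (qe3 1 (- 1)) (qe2 1 (- 1)) (qe1 1 (- 1)) 1 1) => //.
  + exists (fun y => Quat (qc0 y) (qc3 y) (qc2 y) (qc1 y)); quat_coords.
  + by rewrite i3i3 mul1r opprK.
  + by rewrite i2i2 opprK.
  + by rewrite i3i2 scaleN1r opprK.
  + by rewrite i2i3 scaleN1r.
  + by rewrite sqr_sqrtr ?ltW // mulr1.
  + by rewrite sqr_sqrtr ?ltW // mulr1.
  + by rewrite -mulrNN sqrtrM // ltW.
- have pos2 : 0 < - g2 by rewrite oppr_gt0.
  apply: (scaled_units_isomorphism R g1 g2 _
      (qe1 1 (- 1)) (qe2 1 (- 1)) (qe3 1 (- 1)) (- 1) 1) => //.
  + exists (fun y => Quat (qc0 y) (qc1 y) (qc2 y) (qc3 y)); quat_coords.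
  + by rewrite i2i2 opprK.
  + by rewrite sqr_sqrtr ?ltW // mulrN1.
  + by rewrite sqr_sqrtr ?ltW // mulr1.
  + by rewrite -mulrN sqrtrM // ltW.
- have pos1 : 0 < - g1 by rewrite oppr_gt0.
  apply: (scaled_units_isomorphism R g1 g2 _
      (qe3 1 (- 1)) (qe1 1 (- 1)) (qe2 1 (- 1)) 1 (- 1)) => //.
  + exists (fun y => Quat (qc0 y) (qc3 y) (qc1 y) (qc2 y)); quat_coords.
  + by rewrite i3i3 mul1r opprK.
  + by rewrite i3i1 scale1r.
  + by rewrite i1i3 scale1r.
  + by rewrite sqr_sqrtr ?ltW // mulr1.
  + by rewrite sqr_sqrtr ?ltW // mulrN1.
  + by rewrite -mulNr sqrtrM // ltW.
Qed.
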